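(* Let $\mu$ be a ($\sigma$-finite) Borel measure on $M_k(\mathbb{C})$ with $\int \|v\|^2\,d\mu(v)<\infty$ and $\int v^*v\,d\mu(v)=\mathrm{Id}_{\mathbb{C}^k}$. Assume $\operatorname{supp}\mu\subset GL_k(\mathbb{C})$ and that $T_\mu$ is strongly irreducible. Then $\mu$ satisfies (Pur) if and only if $T_\mu$ is contracting.
   Context: $k\ge1$ is an integer, $\mathbb{N}=\{1,2,\dots\}$. $T_\mu$ is the smallest closed sub-semigroup of $GL_k(\mathbb{C})$ containing $\operatorname{supp}\mu$. $T_\mu$ is strongly irreducible if there is no non-trivial finite union of proper subspaces of $\mathbb{C}^k$ that is left invariant by all elements of $T_\mu$ (equivalently by all $v\in\operatorname{supp}\mu$). $T_\mu$ is contracting if there exists a sequence $(a_n)_{n\in\mathbb{N}}\subset T_\mu$ such that $\lim_{n\to\infty}a_n/\|a_n\|$ exists (in $M_k(\mathbb{C})$) and is a rank one matrix. $\mu^{\otimes n}$ is the $n$-fold product measure. $X\propto Y$ means $X=\lambda Y$ for some $\lambda\in\mathbb{C}$. (Pur): any nonzero orthogonal projector $\pi$ on $\mathbb{C}^k$ such that for every $n\in\mathbb{N}$, $\pi v_1^*\cdots v_n^*v_n\cdots v_1\pi\propto\pi$ for $\mu^{\otimes n}$-almost all $(v_1,\dots,v_n)$, is of rank one. *)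

(* Defs.v *)
From HB Require Import structures.
From mathcomp Require Import all_boot all_order all_algebra spectral.
From mathcomp Require Import complex.
From mathcomp Require Import all_classical all_reals all_analysis.

Set Implicit Arguments.
Unset Strict Implicit.
Unset Printing Implicit Defensive.

Import Order.TTheory GRing.Theory Num.Theory.
Import numFieldNormedType.Exports.

Local Open Scope classical_set_scope.
Local Open Scope ring_scope.
Local Open Scope sesquilinear_scope.

(* The library puts the topology of the modulus on R[i]^o only; transporting it
   to R[i] gives 'M[R[i]]_k the usual topology of C^(k x k). *)
Section complex_normedtype.
Variable R : rcfType.
#[export, non_forgetful_inheritance]
HB.instance Definition _ := PseudoPointedMetric.copy R[i] (R[i]^o).
#[export, non_forgetful_inheritance]
HB.instance Definition _ := GRing.ComAlgebra.copy R[i] (R[i]^o).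
#[export, non_forgetful_inheritance]
HB.instance Definition _ := Vector.copy R[i] (R[i]^o).
#[export, non_forgetful_inheritance]
HB.instance Definition _ := NormedModule.copy R[i] (R[i]^o).
#[export, non_forgetful_inheritance]
HB.instance Definition _ := Num.ClosedField.on R[i].
End complex_normedtype.

Section product_measure.
Context d (T : measurableType d) (R : realType).

Variable mu : set T -> \bar R.

Fixpoint mpower (n : nat) {struct n} : set (n.-tuple T) -> \bar R :=
  match n with
  | 0%N => \d_([tuple] : 0.-tuple T)
  | n'.+1 => pushforward (mu \x @mpower n')%E
               (fun p => [the n'.+1.-tuple T of p.1 :: p.2])
  end.

End product_measure.
Arguments mpower {d T R} mu n.

Section matrices.
Context (R : realType) (k : nat).
Local Notation M := 'M[R[i]]_k.

Definition borel_mx := g_sigma_algebraType (@open M).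

Definition GL : set M := [set v | v \in unitmx].

Definition vec_norm (x : 'cV[R[i]]_k) : R :=
  Num.sqrt (\sum_(j < k) ComplexField.Normc.normc (x j 0) ^+ 2).

Definition op_norm (v : M) : R :=
  sup [set vec_norm (v *m x) | x in [set x | vec_norm x <= 1]].

Definition mx_integral (mu : {measure set borel_mx -> \bar R}) (F : M -> M) : M :=
  \matrix_(a, b) ((\int[mu]_v complex.Re (F v a b))
              +i* (\int[mu]_v complex.Im (F v a b)))%C.

Definition supp (mu : set borel_mx -> \bar R) : set M :=
  [set v | forall U : set M, open U -> U v -> (0 < mu U)%E].

(* "Closed" is relative to GL: limits outside GL need not belong to S. *)
Definition closed_subsemigroup (S : set M) : Prop :=
  [/\ S `<=` GL,
      (forall a b, S a -> S b -> S (a *m b)) &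
      exists2 F : set M, closed F & S = F `&` GL].

Definition Tsemigroup (mu : set borel_mx -> \bar R) : set M :=
  smallest closed_subsemigroup (supp mu).

Definition union_of (s : seq {vspace 'cV[R[i]]_k}) : set 'cV[R[i]]_k :=
  [set x | exists2 V, V \in s & x \in V].

(* Besides the empty set, {0} is the trivial union. *)
Definition strongly_irreducible (S : set M) : Prop :=
  ~ exists s : seq {vspace 'cV[R[i]]_k},
    [/\ forall V, V \in s -> V != fullv,
        exists2 x, union_of s x & x != 0 &
        forall a x, S a -> union_of s x -> union_of s (a *m x)].

Definition contracting (S : set M) : Prop :=
  exists2 a : nat -> M, (forall n, S (a n)) &
  exists2 P : M,
    (((op_norm (a n))^-1)%:C%C *: a n) @[n --> \oo] --> P & \rank P = 1%N.

Definition mx_propto (X Y : M) : Prop := exists l : R[i], X = l *: Y.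

Definition ortho_projector (p : M) : Prop := p *m p = p /\ p^t* = p.

(* For t = (v_1, ..., v_n), the products v_1^* ... v_n^* and v_n ... v_1. *)
Definition adj_prod n (t : n.-tuple borel_mx) : M :=
  \big[mulmx/1%:M]_(v <- t) (v : M)^t*.
Definition rev_prod n (t : n.-tuple borel_mx) : M :=
  \big[mulmx/1%:M]_(v <- rev t) (v : M).

Definition Pur (mu : {measure set borel_mx -> \bar R}) : Prop :=
  forall p : M, p != 0 -> ortho_projector p ->
    (forall n, (0 < n)%N ->
       {ae mpower mu n, forall t,
          mx_propto (p *m adj_prod t *m rev_prod t *m p) p}) ->
    \rank p = 1%N.

End matrices.

(* Main.v *)
(** (Pur) concerns the compressions p W* W p, where W runs over the products of
    elements of supp mu; being proportional to p is a closed condition on W, so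
    that it holds for almost all products if and only if it holds for all products
    of elements of supp mu, and then for all of T.

    Contracting implies (Pur). If p satisfies the hypothesis of (Pur) and P is a
    rank one limit of a_n / |a_n| with a_n in T, then p b* P* P b p is proportional
    to p for every b in T. If a factor is nonzero, then p has rank one; otherwise
    the range of p lies in the intersection of the kernels of the P b, which is a
    proper subspace invariant under T.

    (Pur) implies contracting. Among the limits A of positive multiples of elements
    of T with tr A*A = 1, which form a compact set, choose one that maximizes
    s = tr (A*A)^2. For v in supp mu put w = tr (A* v* v A); then
      |A* v* v A - w A*A|^2 <= 2 w (s w - |v A A*|^2)
    by maximality. The last factor is nonnegative on supp mu and has integral 0
    because the integral of v* v is the identity, so it vanishes on supp mu and
    A* v* v A = w A*A. Up to scaling, v A is again a maximizer, hence
    A* W* W A is proportional to A*A for all products W, and the orthogonal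
    projector onto the range of A satisfies the hypothesis of (Pur): A has rank
    one. *)

Require Import Defs.
From mathcomp Require Import all_boot all_order all_algebra spectral complex.
From mathcomp Require Import all_classical all_reals all_analysis.
From mathcomp Require Import ring lra.

Set Implicit Arguments.
Unset Strict Implicit.
Unset Printing Implicit Defensive.

Import Order.TTheory GRing.Theory Num.Theory.
Import numFieldNormedType.Exports.

Local Open Scope classical_set_scope.
Local Open Scope ring_scope.
Local Open Scope sesquilinear_scope.

(** * Convergence of complex matrices *)

Section complex_matrix_convergence.
Context (R : realType) (T : Type) (F : set_system T) {FF : Filter F}.
Local Notation C := R[i].

Lemma complex_gt0_Re (e : C) : 0 < e -> 0 < complex.Re e /\ e = (complex.Re e)%:C%C.
Proof. by case: e => a b; rewrite ltcE /= => /andP[/eqP -> ->]. Qed.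

Lemma cvg_complexP (f : T -> C) (l : C) :
  f @ F --> l <-> forall e : R, 0 < e -> \forall x \near F, `|l - f x| < e%:C%C.
Proof.
split=> [h e e0|h].
  have e0C : 0 < (e%:C%C : C) by rewrite ltcR.
  exact (@cvgr_dist_lt C C T F FF f l h _ e0C).
by apply/(cvgrPdist_lt (FF := FF) (V := C)) => e /complex_gt0_Re[e0 ->]; exact: h.
Qed.

Lemma cvg_conj (f : T -> C) (l : C) :
  f @ F --> l -> (fun x => Num.conj (f x)) @ F --> Num.conj l.
Proof.
move=> /cvg_complexP h; apply/cvg_complexP => e /h.
by apply: filterS => y; rewrite -rmorphB norm_conjC.
Qed.

Lemma cvg_real_complex (f : T -> R) (l : R) :
  f @ F --> l -> (fun x => (f x)%:C%C : C) @ F --> (l%:C%C : C).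
Proof.
move=> h; apply/cvg_complexP => e e0.
have := @cvgr_dist_lt R R T F FF f l h e e0; apply: filterS => y.
by rewrite -rmorphB/= normc_def /= expr0n addr0 sqrtr_sqr ltcR.
Qed.

Lemma cvg_Re (f : T -> C) (l : C) :
  f @ F --> l -> (fun x => complex.Re (f x)) @ F --> complex.Re l.
Proof.
move=> /cvg_complexP h; apply/(cvgrPdist_lt (FF := FF) (V := R)) => e /h.
apply: filterS => y; rewrite -ltcR; apply: le_lt_trans.
have <- : complex.Re (l - f y) = complex.Re l - complex.Re (f y).
  by case: (l) (f y) => ? ? [].
exact: normc_ge_Re.
Qed.

Lemma cvg_complexD (f g : T -> C) (a b : C) :
  f @ F --> a -> g @ F --> b -> (fun x => f x + g x) @ F --> a + b.
Proof.
by move=> fa gb; exact (@cvgD C C T F FF f g a b fa gb).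
Qed.

Lemma cvg_complexM (f g : T -> C) (a b : C) :
  f @ F --> a -> g @ F --> b -> (fun x => f x * g x) @ F --> a * b.
Proof.
by move=> fa gb; exact (@cvgM C T F FF f g a b fa gb).
Qed.

Lemma cvg_complex_sum I (r : seq I) (P : pred I) (f : I -> T -> C) (l : I -> C) :
  (forall i, P i -> f i @ F --> l i) ->
  (fun x => \sum_(i <- r | P i) f i x) @ F --> \sum_(i <- r | P i) l i.
Proof.
move=> h; elim: r => [|i r ih].
  rewrite big_nil; under eq_fun do rewrite big_nil.
  exact (@cvg_cst _ (0 : C) _ F FF).
rewrite big_cons; under eq_fun do rewrite big_cons.
case: ifPn => Pi.
  exact (cvg_complexD (h i Pi) ih).
exact ih.
Qed.

Lemma cvg_mxP m n (f : T -> 'M[C]_(m, n)) (l : 'M[C]_(m, n)) :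
  f @ F --> l <-> forall i j, (fun x => f x i j) @ F --> l i j.
Proof.
split=> [h i j|h].
  have H := @cvg_comp _ _ _ f (fun v : 'M[C]_(m, n) => v i j) F _ _ h
    (@coord_continuous C m n i j l).
  exact H.
move=> U [P hP PU]; rewrite /nbhs /=.
have: \forall x \near F, forall i j, P i j (f x i j).
  by apply: filter_forall => i; apply: filter_forall => j; exact: h (hP i j).
by apply: filterS => y /PU.
Qed.

Lemma cvg_mulmx m n p (f : T -> 'M[C]_(m, n)) (g : T -> 'M[C]_(n, p))
    (a : 'M[C]_(m, n)) (b : 'M[C]_(n, p)) :
  f @ F --> a -> g @ F --> b -> (fun x => f x *m g x) @ F --> a *m b.
Proof.
move=> /cvg_mxP hf /cvg_mxP hg; apply/cvg_mxP => i j.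
rewrite mxE; under eq_fun do rewrite mxE.
apply: cvg_complex_sum => l _.
exact (cvg_complexM (hf i l) (hg l j)).
Qed.

Lemma cvg_adjmx m n (f : T -> 'M[C]_(m, n)) (a : 'M[C]_(m, n)) :
  f @ F --> a -> (fun x => (f x)^t*) @ F --> a^t*.
Proof.
move=> /cvg_mxP hf; apply/cvg_mxP => i j.
rewrite !mxE; under eq_fun do rewrite !mxE.
exact (cvg_conj (hf j i)).
Qed.

Lemma cvg_mxtrace n (f : T -> 'M[C]_n) (a : 'M[C]_n) :
  f @ F --> a -> (fun x => \tr (f x)) @ F --> \tr a.
Proof.
move=> /cvg_mxP hf; apply: cvg_complex_sum => l _.
exact (hf l l).
Qed.

Lemma cvg_scalemx m n (f : T -> C) (g : T -> 'M[C]_(m, n)) (a : C) (b : 'M[C]_(m, n)) :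
  f @ F --> a -> g @ F --> b -> (fun x => f x *: g x) @ F --> a *: b.
Proof.
move=> hf /cvg_mxP hg; apply/cvg_mxP => i j.
rewrite mxE; under eq_fun do rewrite mxE.
exact (cvg_complexM hf (hg i j)).
Qed.

End complex_matrix_convergence.

(** * Frobenius and operator norms *)

Lemma mxtrace_sqr_subZ (K : comNzRingType) n (N M : 'M[K]_n) (w : K) :
  \tr ((N - w *: M) *m (N - w *: M)) =
  \tr (N *m N) - w * \tr (N *m M) - w * \tr (N *m M) + w * w * \tr (M *m M).
Proof.
rewrite mulmxBl !mulmxBr -!scalemxAl -!scalemxAr !linearB /= !mxtraceZ.
by rewrite (mxtrace_mulC M N); ring.
Qed.

Section adjoint_matrices.
Context (R : realType).
Local Notation C := R[i].

Lemma adjmxM m n p (A : 'M[C]_(m, n)) (B : 'M[C]_(n, p)) :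
  (A *m B)^t* = B^t* *m A^t*.
Proof. by rewrite trmx_mul map_mxM. Qed.

Lemma adjmxZ m n (c : C) (A : 'M[C]_(m, n)) : (c *: A)^t* = Num.conj c *: A^t*.
Proof. by rewrite linearZ /= map_mxZ. Qed.

Lemma adjmxB m n (A B : 'M[C]_(m, n)) : (A - B)^t* = A^t* - B^t*.
Proof. by rewrite linearB /= map_mxB. Qed.

Lemma adjmx_self m n (A : 'M[C]_(m, n)) : (A^t* *m A)^t* = A^t* *m A.
Proof. by rewrite adjmxM trmxCK. Qed.

Lemma conj_real (r : R) : Num.conj (r%:C%C : C) = r%:C%C.
Proof. exact: conjc_real. Qed.

Definition sqfrob m n (A : 'M[C]_(m, n)) : R := complex.Re (\tr (A^t* *m A)).

Lemma mxtrace_adj_mul m n (A : 'M[C]_(m, n)) :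
  \tr (A^t* *m A) = \sum_j \sum_i `|A i j| ^+ 2.
Proof.
apply: eq_bigr => j _; rewrite mxE; apply: eq_bigr => i _.
by rewrite !mxE normCK mulrC.
Qed.

Lemma sqfrobE m n (A : 'M[C]_(m, n)) : ((sqfrob A)%:C)%C = \tr (A^t* *m A).
Proof.
rewrite /sqfrob RRe_real // mxtrace_adj_mul ger0_real //.
by do 2![apply: sumr_ge0 => ? _]; exact: exprn_ge0.
Qed.

Lemma sqfrob_ge0 m n (A : 'M[C]_(m, n)) : 0 <= sqfrob A.
Proof.
rewrite -ler0c sqfrobE mxtrace_adj_mul.
by do 2![apply: sumr_ge0 => ? _]; exact: exprn_ge0.
Qed.

Lemma sqfrob_entry m n (A : 'M[C]_(m, n)) i j : `|A i j| ^+ 2 <= ((sqfrob A)%:C)%C.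
Proof.
rewrite sqfrobE mxtrace_adj_mul (bigD1 j) //= (bigD1 i) //= -addrA lerDl.
by apply: addr_ge0; [|apply: sumr_ge0 => ? _]; apply: sumr_ge0 => ? _; exact: exprn_ge0.
Qed.

Lemma sqfrob_eq0 m n (A : 'M[C]_(m, n)) : (sqfrob A == 0) = (A == 0).
Proof.
apply/eqP/eqP => [A0|->]; last by rewrite /sqfrob mulmx0 mxtrace0.
apply/matrixP => i j; rewrite mxE; apply/eqP.
by rewrite -normr_eq0 -sqrf_eq0 eq_le exprn_ge0 // andbT -[0]/((0 : R)%:C%C) -A0 sqfrob_entry.
Qed.

Lemma sqfrob_gt0 m n (A : 'M[C]_(m, n)) : A != 0 -> 0 < sqfrob A.
Proof. by move=> A0; rewrite lt_def sqfrob_ge0 sqfrob_eq0 A0. Qed.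

Lemma sqfrobZ m n (r : R) (A : 'M[C]_(m, n)) : sqfrob (r%:C%C *: A) = r ^+ 2 * sqfrob A.
Proof.
apply: complexI; rewrite rmorphM rmorphXn /= !sqfrobE adjmxZ conj_real.
by rewrite -scalemxAl -scalemxAr scalerA mxtraceZ.
Qed.

(** The projector is the one onto the range of A. Since [proj_ortho] acts on row vectors, it is
    applied to A^*; the factor Z records that the range of p lies in that of A. *)
Lemma ortho_projectorP k (A : 'M[C]_k) :
  exists p : 'M[C]_k, [/\ ortho_projector p, p *m A = A & exists Z, p = A *m Z].
Proof.
set P := proj_ortho (A^t*).
have PP : P *m P = P by exact: proj_ortho_proj.
(* The rows of 1 - P are orthogonal to those of P. As P P^* is self-adjoint, so is P. *)
have Pt : P *m P^t* = P.
  have : P *m (1%:M - P)^t* = 0.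
    apply/orthomx1P; rewrite orthomx_sym.
    rewrite (eqmx_ortho _ (proj_orthoE _)) -[X in (_ - X)]mul1mx.
    exact: proj_ortho_compl_sub.
  rewrite adjmxB mulmxBr => /eqP; rewrite subr_eq0 => /eqP <-.
  by rewrite trmx1 map_mx1 mulmx1.
have Ph : P^t* = P by rewrite -Pt adjmxM trmxCK.
exists P; split; first by split.
- rewrite -[P]Ph -[LHS]trmxCK adjmxM trmxCK.
  by rewrite proj_ortho_id // trmxCK.
- have /submxP[D PD] : (P <= A^t*)%MS by rewrite /P proj_orthoE.
  by exists (D^t*); rewrite -{1}Ph PD adjmxM trmxCK.
Qed.

Lemma sqfrob_adj m n (A : 'M[C]_(m, n)) : sqfrob (A^t*) = sqfrob A.
Proof. by apply: complexI; rewrite !sqfrobE trmxCK mxtrace_mulC. Qed.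

Lemma mxtrace_gramM m n p (X : 'M[C]_(m, n)) (A : 'M[C]_(p, n)) :
  \tr (X^t* *m X *m (A^t* *m A)) = (sqfrob (X *m A^t*))%:C%C.
Proof.
rewrite sqfrobE adjmxM trmxCK; move: (X^t*) (A^t*) => Y B.
by rewrite mulmxA mxtrace_mulC !mulmxA.
Qed.

Lemma sqfrob_mul_gram k (v B : 'M[C]_k) :
  sqfrob (v *m B) = complex.Re (\tr (v^t* *m v *m (B *m B^t*))).
Proof. by have := mxtrace_gramM v (B^t*); rewrite trmxCK => ->. Qed.

Lemma sqfrob_hermitian_sub k (N M : 'M[C]_k) (w c : R) :
  N^t* = N -> M^t* = M -> \tr (N *m M) = c%:C%C ->
  sqfrob (N - w%:C%C *: M) = sqfrob N - 2 * w * c + w ^+ 2 * sqfrob M.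
Proof.
move=> hN hM NM; rewrite /sqfrob adjmxB adjmxZ conj_real hN hM.
rewrite mxtrace_sqr_subZ NM.
by case: (\tr (N *m N)) (\tr (M *m M)) => a1 a2 [b1 b2] /=; ring.
Qed.

(** The cross term of this square is tr ((vA)^* (vA) A^* A) = |v A A^*|^2 by cyclicity of the trace;
    being linear in v^* v, it can be integrated against mu. *)
Lemma sqfrob_gram_sub k (v A : 'M[C]_k) (w : R) :
  sqfrob ((v *m A)^t* *m (v *m A) - w%:C%C *: (A^t* *m A)) =
  sqfrob ((v *m A)^t* *m (v *m A)) - 2 * w * sqfrob (v *m (A *m A^t*))
  + w ^+ 2 * sqfrob (A^t* *m A).
Proof.
apply: sqfrob_hermitian_sub; [exact: adjmx_self|exact: adjmx_self|].
by rewrite mxtrace_gramM mulmxA.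
Qed.

End adjoint_matrices.

Section operator_norm.
Context (R : realType).
Local Notation C := R[i].

Lemma normcE_norm (z : C) : ((ComplexField.Normc.normc z)%:C)%C = `|z|.
Proof. by case: z. Qed.

Lemma sqfrob_sum m n (A : 'M[C]_(m, n)) :
  sqfrob A = \sum_j \sum_i ComplexField.Normc.normc (A i j) ^+ 2.
Proof.
apply: complexI; rewrite sqfrobE mxtrace_adj_mul rmorph_sum; apply: eq_bigr => j _.
rewrite rmorph_sum; apply: eq_bigr => i _.
by rewrite rmorphXn /= normcE_norm.
Qed.

Lemma vec_normE k (x : 'cV[C]_k) : vec_norm x = Num.sqrt (sqfrob x).
Proof. by rewrite /vec_norm sqfrob_sum big_ord1. Qed.

Lemma adjmxD m n (A B : 'M[C]_(m, n)) : (A + B)^t* = A^t* + B^t*.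
Proof. by rewrite linearD /= map_mxD. Qed.

Lemma mxtrace_adj n (A : 'M[C]_n) : \tr (A^t*) = Num.conj (\tr A).
Proof. by rewrite /mxtrace rmorph_sum; apply: eq_bigr => i _; rewrite !mxE. Qed.

Lemma sqfrobD m n (A B : 'M[C]_(m, n)) :
  sqfrob (A + B) = sqfrob A + sqfrob B + 2 * complex.Re (\tr (A^t* *m B)).
Proof.
have BA : \tr (B^t* *m A) = Num.conj (\tr (A^t* *m B)).
  by rewrite -mxtrace_adj adjmxM trmxCK.
rewrite /sqfrob adjmxD mulmxDl !mulmxDr !mxtraceD BA.
by case: (\tr (A^t* *m A)) (\tr (B^t* *m B)) (\tr (A^t* *m B)) => ? ? [? ?] [? ?] /=; ring.
Qed.

Lemma vec_norm_triangle k (x y : 'cV[C]_k) :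
  vec_norm (x + y) <= vec_norm x + vec_norm y.
Proof.
rewrite !vec_normE.
set a := Num.sqrt (sqfrob x); set b := Num.sqrt (sqfrob y).
have a2 : a ^+ 2 = sqfrob x by rewrite sqr_sqrtr ?sqfrob_ge0.
have b2 : b ^+ 2 = sqfrob y by rewrite sqr_sqrtr ?sqfrob_ge0.
have a0 : 0 <= a by exact: sqrtr_ge0.
have b0 : 0 <= b by exact: sqrtr_ge0.
rewrite -(ger0_norm (addr_ge0 a0 b0)) -sqrtr_sqr ler_wsqrtr //.
rewrite sqfrobD -a2 -b2.
set c := complex.Re _.
suff : c <= a * b by nra.
have [/eqP|an0] := eqVneq a 0.
  rewrite -sqrf_eq0 a2 sqfrob_eq0 => /eqP x0.
  by rewrite /c x0 trmx0 map_mx0 mul0mx mxtrace0 mulr_ge0.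
have [/eqP|bn0] := eqVneq b 0.
  rewrite -sqrf_eq0 b2 sqfrob_eq0 => /eqP y0.
  by rewrite /c y0 mulmx0 mxtrace0 mulr_ge0.
(* Cauchy-Schwarz: expanding |b x - a y|^2 >= 0 gives 2 a b (a b - c) >= 0, and a b > 0 can be
   cancelled. *)
have := sqfrob_ge0 (b%:C%C *: x + (- a)%:C%C *: y).
rewrite sqfrobD !sqfrobZ -a2 -b2 adjmxZ conj_real -scalemxAl -scalemxAr scalerA mxtraceZ.
have -> : complex.Re (b%:C%C * (- a)%:C%C * \tr (x^t* *m y)) = b * (- a) * c.
  by rewrite /c; case: (\tr _) => ? ? /=; ring.
have ap : 0 < a by rewrite lt_def an0.
have bp : 0 < b by rewrite lt_def bn0.
have abp := mulr_gt0 ap bp.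
move=> h; rewrite -(ler_pM2l abp); nra.
Qed.

Lemma sqfrob_mulmx_le m n p (A : 'M[C]_(m, n)) (B : 'M[C]_(n, p)) :
  sqfrob (A *m B) <= sqfrob A * sqfrob B.
Proof.
rewrite -lecR rmorphM /= -(sqfrob_adj A) !sqfrobE !mxtrace_adj_mul.
rewrite mulr_suml exchange_big /=; apply: ler_sum => i _.
rewrite mulr_sumr; apply: ler_sum => j _.
(* Cauchy-Schwarz for each entry of A B; [dotmx] conjugates its second argument, which undoes the
   conjugation in B^*. *)
have : `|dotmx (row i A) (row j (B^t*))| ^+ 2 <=
    dotmx (row i A) (row i A) * dotmx (row j (B^t*)) (row j (B^t*)).
  by case: (CauchySchwarz (@dotmx C n) (row i A) (row j (B^t*))).
have -> : dotmx (row i A) (row j (B^t*)) = (A *m B) i j.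
  by rewrite dotmxE !mxE; apply: eq_bigr => l _; rewrite !mxE conjCK.
have -> : dotmx (row i A) (row i A) = \sum_l `|(A^t*) l i| ^+ 2.
  by rewrite dotmxE mxE; apply: eq_bigr => l _; rewrite !mxE norm_conjC normCK.
have -> : dotmx (row j (B^t*)) (row j (B^t*)) = \sum_l `|B l j| ^+ 2.
  by rewrite dotmxE mxE; apply: eq_bigr => l _; rewrite !mxE conjCK mulrC normCK.
by [].
Qed.

Lemma op_norm_set_ub k (v : 'M[C]_k) :
  ubound [set vec_norm (v *m x) | x in [set x | vec_norm x <= 1]] (Num.sqrt (sqfrob v)).
Proof.
move=> _ [x /= x1 <-]; rewrite vec_normE ler_wsqrtr //.
apply: (le_trans (sqfrob_mulmx_le _ _)).
rewrite ler_piMr ?sqfrob_ge0 //.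
have : vec_norm x ^+ 2 <= 1 by rewrite expr_le1 // /vec_norm sqrtr_ge0.
by rewrite vec_normE sqr_sqrtr ?sqfrob_ge0.
Qed.

Lemma op_norm_set_has_sup k (v : 'M[C]_k) :
  has_sup [set vec_norm (v *m x) | x in [set x | vec_norm x <= 1]].
Proof.
split; last by exists (Num.sqrt (sqfrob v)); exact: op_norm_set_ub.
exists (vec_norm (v *m 0)); exists 0 => //=.
by rewrite vec_normE /sqfrob mulmx0 mxtrace0 sqrtr0.
Qed.

Lemma op_norm_le_sqfrob k (v : 'M[C]_k) : op_norm v <= Num.sqrt (sqfrob v).
Proof. by apply: ge_sup; [case: (op_norm_set_has_sup v) | exact: op_norm_set_ub]. Qed.

Lemma op_norm_ge k (v : 'M[C]_k) x : vec_norm x <= 1 -> vec_norm (v *m x) <= op_norm v.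
Proof. by move=> x1; apply: (ub_le_sup (proj2 (op_norm_set_has_sup v))); exists x. Qed.

Lemma op_norm_le k (v : 'M[C]_k) r :
  (forall x, vec_norm x <= 1 -> vec_norm (v *m x) <= r) -> op_norm v <= r.
Proof.
move=> h; apply: ge_sup; first by case: (op_norm_set_has_sup v).
by move=> _ [x /= x1 <-]; exact: h.
Qed.

Lemma op_normD k (a b : 'M[C]_k) : op_norm (a + b) <= op_norm a + op_norm b.
Proof.
apply: op_norm_le => x x1; rewrite mulmxDl (le_trans (vec_norm_triangle _ _)) //.
by rewrite lerD // op_norm_ge.
Qed.

Lemma vec_normZ k (r : R) (x : 'cV[C]_k) : 0 <= r -> vec_norm (r%:C%C *: x) = r * vec_norm x.
Proof.
by move=> r0; rewrite !vec_normE sqfrobZ sqrtrM ?sqr_ge0 // sqrtr_sqr ger0_norm.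
Qed.

Lemma op_normZ k (r : R) (v : 'M[C]_k) : 0 < r -> op_norm (r%:C%C *: v) = r * op_norm v.
Proof.
have le s (w : 'M[C]_k) : 0 <= s -> op_norm (s%:C%C *: w) <= s * op_norm w.
  move=> s0; apply: op_norm_le => x x1.
  by rewrite -scalemxAl vec_normZ // ler_wpM2l // op_norm_ge.
move=> r0; apply/le_anti/andP; split; first exact: le (ltW r0).
(* The reverse inequality is [le] for the factor 1/r and the matrix r v. *)
rewrite -ler_pdivlMl //.
have := le r^-1 (r%:C%C *: v); rewrite scalerA -rmorphM /= mulVf ?gt_eqF // scale1r.
by apply; rewrite invr_ge0 ltW.
Qed.

(** The entry is a coordinate of v e_j, where the basis vector e_j has norm 1. *)
Lemma op_norm_entry k (v : 'M[C]_k) i j : `|v i j| <= ((op_norm v)%:C)%C.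
Proof.
have h1 : vec_norm (delta_mx j 0 : 'cV[C]_k) <= 1.
  rewrite vec_normE -[leRHS]sqrtr1 ler_wsqrtr // -lecR sqfrobE mxtrace_adj_mul.
  rewrite big_ord1 (bigD1 j) //= big1 => [|i' /negPf ij];
    rewrite mxE ?eqxx ?ij ?normr0 ?expr0n //=.
  by rewrite normr1 expr1n addr0.
apply: le_trans (_ : ((vec_norm (v *m delta_mx j 0))%:C)%C <= _); last first.
  by rewrite lecR op_norm_ge.
have s0 := sqfrob_ge0 (v *m (delta_mx j 0 : 'cV[C]_k)).
rewrite -normcE_norm lecR vec_normE.
have n0 : 0 <= ComplexField.Normc.normc (v i j) by rewrite -ler0c normcE_norm.
rewrite -(@ler_sqr R) ?nnegrE ?sqrtr_ge0 // sqr_sqrtr //.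
rewrite -lecR rmorphXn /= normcE_norm -colE.
by apply: le_trans (sqfrob_entry _ i 0); rewrite mxE.
Qed.

Lemma op_norm_ge0 k (v : 'M[C]_k) : 0 <= op_norm v.
Proof.
have h : vec_norm (0 : 'cV[C]_k) <= 1 by rewrite vec_normE /sqfrob mulmx0 mxtrace0 sqrtr0.
by apply: le_trans (op_norm_ge v h); exact: sqrtr_ge0.
Qed.

Lemma op_norm_gt0 k (v : 'M[C]_k) : v != 0 -> 0 < op_norm v.
Proof.
rewrite lt_def op_norm_ge0 andbT; apply: contraNneq => v0.
apply/eqP/matrixP => i j; rewrite mxE; apply/eqP; rewrite -normr_le0.
by have := op_norm_entry v i j; rewrite v0.
Qed.

Lemma cvg_sqfrob T (F : set_system T) (FF : Filter F) m n (f : T -> 'M[C]_(m, n))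
  (l : 'M[C]_(m, n)) :
  f @ F --> l -> (fun x => sqfrob (f x)) @ F --> sqfrob l.
Proof.
move=> fl.
exact (cvg_Re (cvg_mxtrace (cvg_mulmx (cvg_adjmx fl) fl))).
Qed.

Lemma sqfrob_sub_sym m n (a b : 'M[C]_(m, n)) : sqfrob (a - b) = sqfrob (b - a).
Proof.
rewrite -opprB -scaleN1r.
have -> : (-1 : C) = (-1)%:C%C by rewrite rmorphN1.
by rewrite sqfrobZ sqrrN expr1n mul1r.
Qed.

(** The operator norm is 1-Lipschitz for the Frobenius norm, whose square is a polynomial in the
    entries and their conjugates; its continuity follows. *)
Lemma op_norm_dist k (a b : 'M[C]_k) : `|op_norm a - op_norm b| <= Num.sqrt (sqfrob (a - b)).
Proof.
have h (u w : 'M[C]_k) : op_norm u - op_norm w <= Num.sqrt (sqfrob (u - w)).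
  rewrite lerBlDr (le_trans _ (lerD (op_norm_le_sqfrob _) (lexx _))) //.
  by rewrite -{1}[u](subrK w) op_normD.
by rewrite ler_norml h andbT lerNl opprB sqfrob_sub_sym h.
Qed.

Lemma cvg_op_norm T (F : set_system T) (FF : Filter F) k (f : T -> 'M[C]_k) (l : 'M[C]_k) :
  f @ F --> l -> (fun x => op_norm (f x)) @ F --> op_norm l.
Proof.
move=> fl.
have fl0 : (fun x => l - f x) @ F --> (0 : 'M[C]_k).
  apply/cvg_mxP => i j; rewrite mxE.
  have /cvg_complexP h : (fun x => f x i j) @ F --> l i j by move/cvg_mxP : fl; exact.
  apply/cvg_complexP => e /h; apply: filterS => x.
  by rewrite !mxE sub0r normrN.
have sq0 := cvg_sqfrob FF fl0.
have s0 : sqfrob (0 : 'M[C]_k) = 0 by apply/eqP; rewrite sqfrob_eq0.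
rewrite s0 in sq0.
apply/(cvgrPdist_lt (FF := FF) (V := R)) => e e0.
have e2 : 0 < e ^+ 2 by rewrite exprn_gt0.
have := @cvgr_dist_lt R R T F FF _ _ sq0 (e ^+ 2) e2.
apply: filterS => x; rewrite sub0r normrN ger0_norm ?sqfrob_ge0 // => h.
apply: (le_lt_trans (op_norm_dist _ _)).
by rewrite -(ger0_norm (ltW e0)) -sqrtr_sqr ltr_sqrt.
Qed.

End operator_norm.

(** * Closures and compactness of sets of matrices *)

Section matrix_topology.
Context (R : realType).
Local Notation C := R[i].

Lemma cvg_id_mx m n (A : 'M[C]_(m, n)) : (fun x : 'M[C]_(m, n) => x) @ nbhs A --> A.
Proof. by move=> U. Qed.

Lemma nbhs_mx m n (A : 'M[C]_(m, n)) (e : R) : 0 < e ->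
  nbhs A [set B : 'M[C]_(m, n) | forall i j, `|A i j - B i j| < e%:C%C].
Proof.
move=> e0.
suff h i j : nbhs A [set B : 'M[C]_(m, n) | `|A i j - B i j| < e%:C%C].
  have := @filter_forall _ _ (fun i => [set B : 'M[C]_(m, n) |
    forall j, `|A i j - B i j| < e%:C%C]) (nbhs A) (nbhs_filter A).
  apply=> i.
  have := @filter_forall _ _ (fun j => [set B : 'M[C]_(m, n) |
    `|A i j - B i j| < e%:C%C]) (nbhs A) (nbhs_filter A).
  by apply=> j; exact (h i j).
have /cvg_complexP h : (fun x : 'M[C]_(m, n) => x i j) @ nbhs A --> A i j.
  by have /cvg_mxP := @cvg_id_mx m n A; exact.
exact (h e e0).
Qed.

Lemma closure_seq m n (S : set 'M[C]_(m, n)) A : closure S A ->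
  exists2 u : nat -> 'M[C]_(m, n), (forall n, S (u n)) & u @ \oo --> A.
Proof.
move=> SA.
have /choice[u hu] : forall N : nat, exists B, S B /\
    forall i j, `|A i j - B i j| < ((N.+1%:R^-1 : R)%:C)%C.
  move=> N; have [|B [SB hB]] := SA _ (@nbhs_mx _ _ A N.+1%:R^-1 _).
    by rewrite invr_gt0.
  by exists B.
exists u; first by move=> N; case: (hu N).
apply/cvg_mxP => i j; apply/cvg_complexP => e e0.
have := near_infty_natSinv_lt (PosNum e0); apply: filterS => N /= hN.
by case: (hu N) => _ /(_ i j) /lt_trans; apply; rewrite ltcR.
Qed.

Lemma cvg_closure m n (S : set 'M[C]_(m, n)) A (u : nat -> 'M[C]_(m, n)) :
  (forall n, S (u n)) -> u @ \oo --> A -> closure S A.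
Proof.
move=> Su uA U /uA [N _ hN]; exists (u N); split => //; exact: (hN N (leqnn N)).
Qed.

(** Serves to extend stability properties of a set to its closure, one variable at a time. *)
Lemma closure_preimage m n m' n' (f : 'M[C]_(m, n) -> 'M[C]_(m', n'))
  (S : set 'M[C]_(m, n)) (S' : set 'M[C]_(m', n')) :
  (forall A, f x @[x --> A] --> f A) ->
  (forall A, S A -> closure S' (f A)) -> forall A, closure S A -> closure S' (f A).
Proof.
move=> cf SS' A SA; apply: closed_closure => U UfA.
have [B [SB UB]] := SA _ (cf A U UfA).
by exists (f B); split => //; exact: SS'.
Qed.

(** Real coordinates on the complex matrices, real parts first: the image of the compact cube
    [-1, 1]^(2 k^2) contains every matrix with entries of modulus at most 1. *)
Definition realify_mx k (v : 'rV[R]_(k * k + k * k)) : 'M[C]_k :=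
  \matrix_(i, j) ((v 0 (lshift _ (mxvec_index i j)))%:C +
                  'i * (v 0 (rshift _ (mxvec_index i j)))%:C)%C.

Lemma realify_mx_continuous k : continuous (@realify_mx k).
Proof.
move=> v.
have h l : (fun x : 'rV[R]_(k * k + k * k) => ((x 0 l)%:C)%C : C) @ nbhs v -->
    (((v 0 l)%:C)%C : C).
  exact (cvg_real_complex (FF := nbhs_filter v) (@coord_continuous R _ _ _ _ v)).
apply/(cvg_mxP (FF := nbhs_filter v)) => i j; rewrite mxE; under eq_fun do rewrite mxE.
have c0 := @cvg_cst _ ('i : C)%C _ (nbhs v) (nbhs_filter v).
exact (cvg_complexD (FF := nbhs_filter v) (h _) (cvg_complexM (FF := nbhs_filter v) c0 (h _))).
Qed.

Lemma bounded_mx_subcompact k :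
  exists2 K : set 'M[C]_k, compact K & forall A : 'M[C]_k, (forall i j, `|A i j| <= 1) -> K A.
Proof.
exists (@realify_mx k @`
    [set v : 'rV[R]_(k * k + k * k) | forall i, v ord0 i \in `[(-1 : R), 1]]).
  apply: continuous_compact; first exact/continuous_subspaceT/realify_mx_continuous.
  apply: (@rV_compact _  _ (fun=> `[(-1 : R), 1]%classic)).
  by move=> _; apply: segment_compact.
move=> A hA.
exists (row_mx (mxvec (map_mx (@complex.Re R) A)) (mxvec (map_mx (@complex.Im R) A))).
  move=> i /=; rewrite mxE; case: (fintype.split i) => {}i; case/mxvec_indexP: i => a b.
    rewrite mxvecE mxE in_itv /= -ler_norml -lecR.
    by apply: le_trans (hA a b); exact: normc_ge_Re.
  rewrite mxvecE mxE in_itv /= -ler_norml -lecR.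
  apply: le_trans (hA a b).
  rewrite normc_def lecR -sqrtr_sqr ler_wsqrtr // lerDr; exact: sqr_ge0.
apply/matrixP => i j; rewrite mxE row_mxEl row_mxEr !mxvecE !mxE.
by rewrite -complexE.
Qed.

End matrix_topology.

(** * Powers and support of a measure on matrices *)

Section integral_complements.
Context d (T : measurableType d) (R : realType) (mu : {measure set T -> \bar R}).
Local Open Scope ereal_scope.

(* The measure of a section of a set under [mpower] is not known to depend
   measurably on the first letter, which rules out [ge0_le_integral]. *)
Lemma ge0_le_integralT (f g : T -> \bar R) :
  (forall x, 0 <= f x) -> (forall x, f x <= g x) -> \int[mu]_x f x <= \int[mu]_x g x.
Proof.
move=> f0 fg; have g0 x : 0 <= g x by exact: le_trans (f0 x) (fg x).
rewrite (ge0_integralTE mu f0) (ge0_integralTE mu g0).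
apply: le_ereal_sup => _ [h hf <-]; exists h => // x.
exact: le_trans (hf x) (fg x).
Qed.

(** As f need not be measurable, it is compared with the measurable function equal to +oo on Z and 0
    elsewhere. *)
Lemma integral_null_support (f : T -> \bar R) (Z : set T) :
  measurable Z -> mu Z = 0 -> (forall x, 0 <= f x) -> (forall x, ~ Z x -> f x = 0) ->
  \int[mu]_x f x = 0.
Proof.
move=> mZ Z0 f0 fZ; apply/eqP; rewrite eq_le integral_ge0 // andbT.
apply: (@le_trans _ _ (\int[mu]_x ((cst +oo : T -> \bar R) \_ Z) x)).
  apply: ge0_le_integralT => // x; rewrite patchE; case: ifPn => [_|]; first exact: leey.
  by rewrite notin_setE => /fZ ->.
rewrite -integral_mkcond null_set_integral //; exact: measurable_cst.
Qed.

Lemma integral_ge_pos (U : set T) (r : R) : measurable U -> 0 < mu U -> (0 < r)%R ->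
  exists2 c : R, (0 < c)%R & forall f : T -> \bar R, (forall x, 0 <= f x) ->
    (forall x, U x -> r%:E <= f x) -> c%:E <= \int[mu]_x f x.
Proof.
move=> mU U0 r0.
(* The measure of U may be infinite; then c = 1 will do. *)
have [c c0 cU] : exists2 c : R, (0 < c)%R & c%:E <= r%:E * mu U.
  case: (mu U) U0 => [u||] //= u0.
    by exists (r * u)%R => //; rewrite mulr_gt0.
  by exists 1%R => //; rewrite mulry gtr0_sg // mul1e leey.
exists c => // f f0 fU; apply: (le_trans cU).
rewrite -[U]setIT -integral_indic // -(integralZl_indic _ (fun=> U)) //; last first.
  by move=> r0'; move: (lt_trans r0 r0'); rewrite ltxx.
apply: ge0_le_integralT => x; first by rewrite lee_fin mulr_ge0 // ltW.
rewrite indicE; case: (boolP (x \in U)) => [/set_mem /fU|_]; first by rewrite mulr1.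
by rewrite mulr0.
Qed.

Lemma mpowerS n (N : set (n.+1.-tuple T)) :
  mpower mu n.+1 N =
  \int[mu]_v mpower mu n [set t : n.-tuple T | N [tuple of v :: t]].
Proof.
rewrite /= /pushforward /product_measure1; apply: eq_integral => v _ /=.
by congr (mpower _ _ _); apply/seteqP; split => t; rewrite /xsection /= ?inE.
Qed.

Lemma mpower_ge0 n (N : set (n.-tuple T)) : 0 <= mpower mu n N.
Proof.
elim: n N => [|n ih] N; first by rewrite /= diracE lee_fin.
by rewrite mpowerS integral_ge0.
Qed.

(** Induction on n: first letters in Z form a null set, and for any other first letter the section
    is the same set for the remaining letters. *)
Lemma mpower_null (Z : set T) n : measurable Z -> mu Z = 0 ->
  mpower mu n [set t : n.-tuple T | exists i, Z (tnth t i)] = 0.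
Proof.
move=> mZ Z0; elim: n => [|n ih].
  rewrite /= diracE; case: (boolP (_ \in _)) => //; rewrite inE => -[[]]//.
rewrite mpowerS; apply: (integral_null_support mZ Z0) => [x|v Zv].
  exact: mpower_ge0.
rewrite -[RHS]ih; congr (mpower _ _ _); apply/seteqP; split => t /=; case=> i.
  case: (unliftP ord0 i) => [j ->|->]; first by rewrite tnthS => Zj; exists j.
  by rewrite tnth0.
by move=> Zi; exists (lift ord0 i); rewrite tnthS.
Qed.

Lemma measurable_exists_tnth (Z : set T) n : measurable Z ->
  measurable [set t : n.-tuple T | exists i, Z (tnth t i)].
Proof.
move=> mZ.
have -> : [set t : n.-tuple T | exists i, Z (tnth t i)] =
    \bigcup_(i in [set: 'I_n]) (setT `&` (fun t : n.-tuple T => tnth t i) @^-1` Z).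
  apply/seteqP; split => t /=; first by case=> i Zi; exists i.
  by case=> i _ [_ Zi]; exists i.
by apply: fin_bigcup_measurable => // i _; apply: measurable_tnth.
Qed.

End integral_complements.

Section borel_matrices.
Context (R : realType) (k : nat).
Local Notation C := R[i].
Local Notation M := 'M[C]_k.

Lemma open_measurable_mx (U : set M) : open U -> measurable (U : set (borel_mx R k)).
Proof. by move=> oU; exact: sub_sigma_algebra. Qed.

Lemma nbhs_open (A : set M) : (forall x, A x -> nbhs x A) -> open A.
Proof. by move=> h; rewrite openE. Qed.

Lemma open_preimage_mx (f : M -> R) (D : set R) :
  (forall A, f x @[x --> A] --> f A) -> open D -> open (f @^-1` D).
Proof.
move=> cf oD; rewrite openE => A /= DfA; rewrite /interior.
have := cf A D; apply; exact: open_nbhs_nbhs.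
Qed.

Lemma continuous_measurable_mx (f : M -> R) :
  (forall A, f x @[x --> A] --> f A) -> measurable_fun setT (f : borel_mx R k -> R).
Proof.
move=> cf; apply: (measurability _ (measurable_realfun.RGenOpens.measurableE R)).
move=> _ [_ [a [b ->]] <-]; rewrite setTI.
by apply: open_measurable_mx; apply: open_preimage_mx => //; exact: interval_open.
Qed.

(** Otherwise one counterexample for each N would give a sequence outside U converging to A. *)
Lemma nbhs_mx_nat (A : M) (U : set M) : nbhs A U ->
  exists N : nat, forall B : M,
    (forall i j, `|A i j - B i j| < ((N.+1%:R^-1 : R)%:C)%C) -> U B.
Proof.
move=> AU; apply: contrapT => h.
have : closure (~` U) A; last by move=> /(_ U AU)[B []].
have /choice[u hu] : forall N : nat, exists B : M,
    (forall i j, `|A i j - B i j| < ((N.+1%:R^-1 : R)%:C)%C) /\ ~ U B.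
  move=> N; apply: contrapT => h'; apply: h; exists N => B hB.
  by apply: contrapT => UB; apply: h'; exists B.
apply: (@cvg_closure _ _ _ _ _ u); first by move=> n; case: (hu n).
apply/cvg_mxP => i j; apply/cvg_complexP => e e0.
have := near_infty_natSinv_lt (PosNum e0); apply: filterS => N /= hN.
by case: (hu N) => /(_ i j) /lt_trans + _; apply; rewrite ltcR.
Qed.

Lemma complex_rat_approx (z : C) (e : R) : 0 < e ->
  exists q : rat * rat, `|z - (ratr q.1 +i* ratr q.2)%C| < e%:C%C.
Proof.
move=> e0; have e2 : 0 < e / 2 by rewrite divr_gt0.
have approx (x : R) : exists q : rat, `|x - ratr q| < e / 2.
  have [|q /=] := @rat_in_itvoo R (x - e / 2) (x + e / 2); first by lra.
  by rewrite in_itv /= => /andP[h1 h2]; exists q; rewrite ltr_norml; lra.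
have [q1 h1] := approx (complex.Re z); have [q2 h2] := approx (complex.Im z).
exists (q1, q2); case: z h1 h2 => a b /= h1 h2.
rewrite normc_def ltcR /= -(ger0_norm (ltW e0)) -sqrtr_sqr ltr_sqrt ?exprn_gt0 //.
have := sqr_ge0 (a - ratr q1); have := sqr_ge0 (b - ratr q2).
rewrite -[(a - _) ^+ 2]real_normK ?num_real // -[(b - _) ^+ 2]real_normK ?num_real //.
have := normr_ge0 (a - ratr q1); have := normr_ge0 (b - ratr q2).
by nra.
Qed.

(** A countable base of the topology. The radius is half that of [nbhs_mx_nat], the other half being
    spent on the rational approximation of the centre. *)
Definition rat_box (c : 'M[rat * rat]_k * nat) : set M :=
  [set B | forall i j, `|(ratr (c.1 i j).1 +i* ratr (c.1 i j).2)%C - B i j| <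
                        ((2 * c.2.+1%:R)^-1 : R)%:C%C].

Lemma rat_box_basis (A : M) (U : set M) : nbhs A U ->
  exists2 c, rat_box c A & rat_box c `<=` U.
Proof.
move=> /nbhs_mx_nat[N hN].
have e0 : 0 < (2 * N.+1%:R)^-1 :> R by rewrite invr_gt0 mulr_gt0.
pose q := \matrix_(i, j) xget (0, 0) [set q : rat * rat |
   `|A i j - (ratr q.1 +i* ratr q.2)%C| < ((2 * N.+1%:R)^-1 : R)%:C%C].
have qA i j : `|A i j - (ratr (q i j).1 +i* ratr (q i j).2)%C| < ((2 * N.+1%:R)^-1 : R)%:C%C.
  rewrite mxE; case: xgetP => [y -> //|h].
  by have [y hy] := complex_rat_approx (A i j) e0; have := h y hy.
exists (q, N) => [i j|B hB]; first by rewrite distrC.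
apply: hN => i j.
have -> : A i j - B i j = (A i j - (ratr (q i j).1 +i* ratr (q i j).2)%C) +
   ((ratr (q i j).1 +i* ratr (q i j).2)%C - B i j) by rewrite addrA subrK.
apply: (le_lt_trans (ler_normD _ _)).
apply: (lt_le_trans (ltrD (qA i j) (hB i j))).
rewrite -rmorphD lecR /= invfM -mulrDl.
have -> : (2^-1 + 2^-1 : R) = 1 by lra.
by rewrite mul1r.
Qed.

Variable mu : {measure set (borel_mx R k) -> \bar R}.

Lemma supp_open_pos (v : M) U : supp mu v -> open U -> U v -> (0 < mu U)%E.
Proof. by move=> sv oU Uv; exact: sv. Qed.

Lemma suppC_null_nbhs (v : M) : ~ supp mu v ->
  exists U : set M, [/\ open U, U v & mu U = 0%E].
Proof.
move=> nv; apply: contrapT => h; apply: nv => U oU Uv.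
rewrite lt_def measure_ge0 andbT; apply/eqP => U0; apply: h; exists U; split => //.
Qed.

Lemma suppC_open : open (~` supp mu).
Proof.
apply: nbhs_open => v /suppC_null_nbhs[U [oU Uv U0]].
apply: filterS (open_nbhs_nbhs (conj oU Uv)) => w Uw sw.
by have := sw U oU Uw; rewrite U0 ltxx.
Qed.

Lemma suppC_measurable : measurable (~` supp mu : set (borel_mx R k)).
Proof. apply: open_measurable_mx; exact suppC_open. Qed.

(** A Lindelöf argument: each point outside the support lies in a rational box contained in a null
    open set, and there are only countably many boxes. *)
Lemma measure_suppC : mu (~` supp mu) = 0%E.
Proof.
pose P c (U : set M) := [/\ open U, mu U = 0%E & rat_box c `<=` U].
(* Chooses one null open set around the box coded by n, or the empty set if n codes no box or there
   is no such open set. *)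
pose F (n : nat) : set M := if unpickle n is Some c then xget set0 (P c) else set0.
have F0 n : mu.-negligible (F n : set (borel_mx R k)).
  rewrite /F; case: unpickle => [c|]; last exact: negligible_set0.
  have [[V PV]|nP] := pselect (exists V, P c V).
    have [oU U0 _] := xgetI set0 PV.
    by exists (xget set0 (P c)); split; [exact (open_measurable_mx oU)|exact U0|].
  rewrite xgetPN; first exact: negligible_set0.
  by move=> V PV; apply: nP; exists V.
apply: measure_negligible; first exact: suppC_measurable.
apply: negligibleS (negligible_bigcup F0) => v /suppC_null_nbhs[U [oU Uv U0]].
have [c cv cU] := rat_box_basis (open_nbhs_nbhs (conj oU Uv)).
exists (pickle c) => //; rewrite /F pickleK.
have [_ _] : P c (xget set0 (P c)) by apply: (@xgetI _ set0 _ U).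
exact.
Qed.

End borel_matrices.

(** * Linearity of finite real integrals *)

Section has_integral.
Context d (T : measurableType d) (R : realType) (mu : {measure set T -> \bar R}).

(** Integrability is bundled with the value so that linear combinations carry both along. *)
Definition has_integral (f : T -> R) (r : R) :=
  mu.-integrable setT (EFin \o f) /\ (\int[mu]_x (f x)%:E)%E = r%:E.

Lemma has_integralZ (c : R) f r : has_integral f r -> has_integral (fun x => c * f x) (c * r).
Proof.
move=> [fi fr]; split.
  have -> : EFin \o (fun x => c * f x) = (fun x => c%:E * (EFin \o f) x)%E.
    by apply/funext => x /=; rewrite EFinM.
  exact: integrableZl.
under eq_integral do rewrite EFinM.
by rewrite (@integralZl _ _ _ _ _ _ (EFin \o f)) // fr EFinM.
Qed.

Lemma has_integral_sum I (s : seq I) (f : I -> T -> R) (r : I -> R) :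
  (forall i, has_integral (f i) (r i)) ->
  has_integral (fun x => \sum_(i <- s) f i x) (\sum_(i <- s) r i).
Proof.
move=> fr.
have e x : ((\sum_(i <- s) f i x)%:E = \sum_(i <- s) (f i x)%:E)%E by rewrite -sumEFin.
split.
  have -> : EFin \o (fun x => \sum_(i <- s) f i x) = (fun x => \sum_(i <- s) (EFin \o f i) x)%E.
    by apply/funext => x; exact: e.
  by apply: integrable_sum => // i _; case: (fr i).
under eq_integral do rewrite e.
rewrite integral_sum //; last by move=> i; case: (fr i).
by rewrite -sumEFin; apply: eq_bigr => i _; case: (fr i).
Qed.

Lemma has_integralB f g r s : has_integral f r -> has_integral g s ->
  has_integral (fun x => f x - g x) (r - s).
Proof.
move=> [fi fr] [gi gs]; split.
  have -> : EFin \o (fun x => f x - g x) = ((EFin \o f) \- (EFin \o g))%E.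
    by apply/funext => x /=; rewrite EFinB.
  exact: integrableB.
under eq_integral do rewrite EFinB.
by rewrite (@integralB _ _ _ _ _ _ (EFin \o f) (EFin \o g)) // fr gs EFinB.
Qed.

Lemma has_integral_Rintegral f : mu.-integrable setT (EFin \o f) ->
  has_integral f (\int[mu]_x f x).
Proof. by move=> fi; split => //; rewrite /Rintegral fineK // integrable_fin_num. Qed.

End has_integral.

(** * Words in the support and their mass *)

Section product_words.
Context (R : realType) (k : nat).
Local Notation C := R[i].
Local Notation M := 'M[C]_k.

(* The letters act in reading order: [:: v1; v2] is sent to v2 *m v1. *)
Definition word_prod (s : seq M) : M := \big[mulmx/1%:M]_(v <- rev s) v.

Lemma mulmx_big_cat (s t : seq M) :
  \big[mulmx/1%:M]_(v <- s ++ t) v =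
  \big[mulmx/1%:M]_(v <- s) v *m \big[mulmx/1%:M]_(v <- t) v.
Proof.
elim: s => [|v s ih]; first by rewrite big_nil mul1mx.
by rewrite cat_cons !big_cons ih mulmxA.
Qed.

Lemma word_prod_nil : word_prod [::] = 1%:M.
Proof. by rewrite /word_prod big_nil. Qed.

Lemma word_prod_cat s t : word_prod (s ++ t) = word_prod t *m word_prod s.
Proof. by rewrite /word_prod rev_cat mulmx_big_cat. Qed.

Lemma word_prod_seq1 v : word_prod [:: v] = v.
Proof. by rewrite /word_prod big_cons big_nil mulmx1. Qed.

Lemma word_prod_cons v s : word_prod (v :: s) = word_prod s *m v.
Proof. by rewrite -cat1s word_prod_cat word_prod_seq1. Qed.

Lemma adj_word_prod (s : seq M) :
  \big[mulmx/1%:M]_(v <- s) v^t* = (word_prod s)^t*.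
Proof.
elim: s => [|v s ih]; first by rewrite word_prod_nil big_nil trmx1 map_mx1.
by rewrite big_cons ih word_prod_cons adjmxM.
Qed.

Lemma mulmx_continuous2 (a b : M) (O : set M) : nbhs (a *m b) O ->
  exists2 P : set M * set M, nbhs a P.1 /\ nbhs b P.2 &
    P.1 `*` P.2 `<=` [set x : M * M | O (x.1 *m x.2)].
Proof.
have h1 : (fun x : M * M => x.1) @ nbhs (a, b) --> a by exact: cvg_fst.
have h2 : (fun x : M * M => x.2) @ nbhs (a, b) --> b by exact: cvg_snd.
by move=> /(cvg_mulmx (FF := nbhs_filter (a, b)) h1 h2).
Qed.

Variable mu : {measure set (borel_mx R k) -> \bar R}.

(* The bound has to be uniform in N: it is integrated over the first letter, on
   which the section of N depends. *)
Lemma mpower_supp_open n (t : n.-tuple (borel_mx R k)) (O : set M) :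
  (forall i, supp mu (tnth t i)) -> open O -> O (word_prod t) ->
  exists2 r : R, 0 < r & forall N,
    [set t' : n.-tuple (borel_mx R k) | O (word_prod t')] `<=` N ->
    (r%:E <= mpower mu n N)%E.
Proof.
elim: n t O => [|n ih] t O st oO Ot.
  exists 1 => // N hN; rewrite /= diracE mem_set //.
  by apply: hN; rewrite /= word_prod_nil; move: Ot; rewrite (tuple0 t) word_prod_nil.
case/tupleP: t st Ot => v t st; rewrite word_prod_cons => Ot.
(* By continuity of the product, every first letter in U has a section containing all words with
   product in V. The induction bounds these sections below by one r, and integrating r over U yields
   c. *)
have [V [U [oV Vt oU Uv hU]]] : exists V U : set M,
    [/\ open V, V (word_prod t), open U, U v & forall a b, V a -> U b -> O (a *m b)].
  have [P [hP1 hP2] hP] := mulmx_continuous2 (open_nbhs_nbhs (conj oO Ot)).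
  exists (P.1)°, (P.2)°;
  split; [exact: open_interior|exact: hP1|exact: open_interior|exact: hP2|].
  move=> a b a1 b1; apply: (hP (a, b)).
  by split; apply: interior_subset.
have st' i : supp mu (tnth t i) by have := st (lift ord0 i); rewrite tnthS.
have [r r0 hr] := ih t V st' oV Vt.
have sv : supp mu v by have := st ord0; rewrite tnth0.
have [c c0 hc] := integral_ge_pos (open_measurable_mx oU) (supp_open_pos sv oU Uv) r0.
exists c => // N hN; rewrite mpowerS; apply: hc => [x|x Ux]; first exact: mpower_ge0.
apply: hr => t' Vt'; apply: hN; rewrite /= word_prod_cons; exact: hU.
Qed.

(** If h v > 0, then h > h v / 2 on an open set of positive measure. Since mu is carried by its
    support, h >= 0 almost everywhere and its integral would be positive. *)
Lemma continuous_integral0_supp (h : M -> R) :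
  (forall A, h x @[x --> A] --> h A) -> has_integral mu h 0 ->
  (forall v, supp mu v -> 0 <= h v) -> forall v, supp mu v -> h v = 0.
Proof.
move=> ch [ih h0] hp v sv; apply/eqP; rewrite eq_le hp // andbT leNgt; apply/negP => hv.
have mh := continuous_measurable_mx ch.
have oU : open (h @^-1` [set x | h v / 2 < x]).
  by apply: open_preimage_mx => //; exact: open_gt.
have Uv : (h @^-1` [set x | h v / 2 < x]) v by rewrite /= ltr_pdivrMr // ltr_pMr // ltr1n.
have hv2 : 0 < h v / 2 by rewrite divr_gt0.
have [c c0 hc] := integral_ge_pos (open_measurable_mx oU) (supp_open_pos sv oU Uv) hv2.
(* The bound needs a function that is nonnegative everywhere, hence the absolute value; it agrees
   with h on the support. *)
have : (c%:E <= \int[mu]_x `|(h x)%:E|)%E.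
  apply: hc => // x /= /ltW hx; rewrite lee_fin; apply: (le_trans hx); exact: ler_norm.
rewrite (_ : \int[mu]_x `|(h x)%:E| = 0)%E; first by rewrite lee_fin leNgt c0.
transitivity (\int[mu]_x (h x)%:E)%E; last exact: h0.
apply: ae_eq_integral => //.
- apply/measurable_realfun.measurable_EFinP.
  apply: (measurableT_comp (f := @Num.norm _ R)) => //; exact: normr_measurable.
- exact/measurable_realfun.measurable_EFinP.
- exists (~` supp mu); split; [exact: suppC_measurable|exact: measure_suppC|].
  move=> x /= hx sx; apply: hx => _.
  by rewrite ger0_norm // hp.
Qed.

End product_words.

(** * Integration of v* v *)

Section gram_integral.
Context (R : realType) (k : nat).
Local Notation C := R[i].
Local Notation M := 'M[C]_k.
Variable mu : {measure set (borel_mx R k) -> \bar R}.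
Hypothesis mu_fin : (\int[mu]_v ((op_norm v) ^+ 2)%:E < +oo)%E.
Hypothesis mu_id : mx_integral mu (fun v => v^t* *m v) = 1%:M.

Lemma gram_entry_le (v : M) a b :
  `|(v^t* *m v) a b| <= (k%:R * op_norm v ^+ 2)%:C%C.
Proof.
rewrite mxE; apply: (le_trans (ler_norm_sum _ _ _)).
have -> : (k%:R * op_norm v ^+ 2)%:C%C = \sum_(i < k) ((op_norm v)%:C * (op_norm v)%:C)%C :> C.
  by rewrite sumr_const card_ord -[RHS]mulr_natl -(rmorph_nat (real_complex R)) -!rmorphM expr2.
apply: ler_sum => i _; rewrite normrM !mxE norm_conjC.
by rewrite ler_pM // op_norm_entry.
Qed.

Lemma cvg_gram_entry (A : M) a b :
  (fun v : M => (v^t* *m v) a b) @ nbhs A --> (A^t* *m A) a b.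
Proof.
have h := @cvg_id_mx R k k A.
have /cvg_mxP := cvg_mulmx (FF := nbhs_filter A) (cvg_adjmx (FF := nbhs_filter A) h) h.
by apply.
Qed.

(** Reduces continuity of the imaginary part to [cvg_Re]. *)
Lemma Im_Re (z : C) : complex.Im z = complex.Re (z * (- 'i)%C).
Proof. by case: z => a b /=; ring. Qed.

Lemma normc_ge_Im (z : C) : (`|complex.Im z|%:C)%C <= `|z|.
Proof.
by rewrite normc_def lecR -sqrtr_sqr ler_wsqrtr // lerDr sqr_ge0.
Qed.

Lemma integrable_op_norm_sqr :
  mu.-integrable setT (fun v : borel_mx R k => (k%:R * op_norm (v : M) ^+ 2)%:E).
Proof.
have : mu.-integrable setT (fun v : borel_mx R k => (op_norm (v : M) ^+ 2)%:E).
  apply/integrableP; split.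
    apply/measurable_realfun.measurable_EFinP; apply: continuous_measurable_mx => A.
    have h := cvg_op_norm (nbhs_filter A) (@cvg_id_mx R k k A).
    by have := @cvgM R _ (nbhs A) (nbhs_filter A) _ _ _ _ h h.
  rewrite (eq_integral (fun v : borel_mx R k => (op_norm (v : M) ^+ 2)%:E)) // => v _.
  by rewrite gee0_abs // lee_fin sqr_ge0.
move=> /(@integrableZl _ _ _ mu setT measurableT k%:R).
by congr (mu.-integrable _ _); apply/funext => v; rewrite EFinM.
Qed.

Lemma integrable_dominated (f : M -> R) :
  (forall A, f x @[x --> A] --> f A) -> (forall v, `|f v| <= k%:R * op_norm v ^+ 2) ->
  mu.-integrable setT (EFin \o f).
Proof.
move=> cf fle; apply: (le_integrable measurableT _ _ integrable_op_norm_sqr).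
  apply/measurable_realfun.measurable_EFinP; exact: continuous_measurable_mx.
move=> v _; rewrite /= lee_fin (le_trans (fle v)) //; exact: ler_norm.
Qed.

(** The hypothesis on [mx_integral] supplies the value only; integrability comes from domination by
    k |v|^2. *)
Lemma has_integral_gram_Re a b :
  has_integral mu (fun v : M => complex.Re ((v^t* *m v) a b)) (a == b)%:R.
Proof.
have hi : mu.-integrable setT (EFin \o (fun v : M => complex.Re ((v^t* *m v) a b))).
  apply: integrable_dominated => [A|v].
    exact (cvg_Re (FF := nbhs_filter A) (cvg_gram_entry (A := A) (a := a) (b := b))).
  by rewrite -lecR; apply: le_trans (gram_entry_le v a b); exact: normc_ge_Re.
have := has_integral_Rintegral hi; congr has_integral.
move/matrixP: mu_id => /(_ a b); rewrite !mxE => /(congr1 (@complex.Re R)) /= ->.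
by case: (a == b).
Qed.

Lemma has_integral_gram_Im a b :
  has_integral mu (fun v : M => complex.Im ((v^t* *m v) a b)) 0.
Proof.
have hi : mu.-integrable setT (EFin \o (fun v : M => complex.Im ((v^t* *m v) a b))).
  apply: integrable_dominated => [A|v].
    rewrite Im_Re; under eq_fun do rewrite Im_Re.
    have c0 := @cvg_cst _ (- 'i : C)%C _ (nbhs A) (nbhs_filter A).
    exact (cvg_Re (FF := nbhs_filter A) (cvg_complexM (FF := nbhs_filter A)
      (cvg_gram_entry (A := A) (a := a) (b := b)) c0)).
  by rewrite -lecR; apply: le_trans (gram_entry_le v a b); exact: normc_ge_Im.
have := has_integral_Rintegral hi; congr has_integral.
move/matrixP: mu_id => /(_ a b); rewrite !mxE => /(congr1 (@complex.Im R)) /= ->.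
by case: (a == b).
Qed.

Lemma Re_mxtraceM (A B : M) : complex.Re (\tr (A *m B)) =
  \sum_a \sum_b (complex.Re (B b a) * complex.Re (A a b) -
    complex.Im (B b a) * complex.Im (A a b)).
Proof.
have ReD : {morph @complex.Re R : x y / x + y >-> x + y} by case=> ? ? [].
rewrite /mxtrace (big_morph _ ReD (erefl _)); apply: eq_bigr => a _.
rewrite mxE (big_morph _ ReD (erefl _)); apply: eq_bigr => b _.
by case: (A a b) (B b a) => ? ? [? ?] /=; ring.
Qed.

Lemma has_integral_sqfrob (B : M) :
  has_integral mu (fun v : M => sqfrob (v *m B)) (sqfrob B).
Proof.
under eq_fun do rewrite sqfrob_mul_gram Re_mxtraceM.
set G := B *m B^t*.
have -> : sqfrob B = \sum_a \sum_b (complex.Re (G b a) * (a == b)%:R - complex.Im (G b a) * 0).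
  rewrite -sqfrob_adj /sqfrob trmxCK -/G.
  rewrite -[G]mul1mx Re_mxtraceM; apply: eq_bigr => a _; apply: eq_bigr => b _.
  by rewrite !mul1mx !mxE; case: (a == b); rewrite /= ?mulr0.
apply: has_integral_sum => a; apply: has_integral_sum => b.
apply: has_integralB; apply: has_integralZ.
  exact: has_integral_gram_Re.
exact: has_integral_gram_Im.
Qed.

End gram_integral.

(** * Contracting implies (Pur) *)

(** V has maximal dimension among the subspaces contained in Q: a vector of Q outside V would span
    with V a larger one. *)
Lemma vspace_of_linear_closed (K : fieldType) (vT : vectType K) (Q : vT -> Prop) :
  Q 0 -> (forall a x y, Q x -> Q y -> Q (a *: x + y)) ->
  exists V : {vspace vT}, forall x, x \in V <-> Q x.
Proof.
move=> Q0 Ql.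
pose P n := `[< exists V : {vspace vT}, \dim V = n /\ forall x, x \in V -> Q x >].
have P0 : exists n, P n.
  exists 0%N; apply/asboolP; exists 0%VS; split; first exact: dimv0.
  by move=> x; rewrite memv0 => /eqP ->.
have Pb n : P n -> (n <= \dim {:vT})%N.
  by move=> /asboolP[V [<- _]]; apply: dimvS; exact: subvf.
case: (ex_maxnP P0 Pb) => n /asboolP[V [dV VQ]] nmax.
exists V => x; split=> [|Qx]; first exact: VQ.
apply: contrapT => /negP xV.
have VxQ y : y \in (<[x]> + V)%VS -> Q y.
  by move=> /memv_addP[_ /vlineP[a ->] [z /VQ Qz ->]]; exact: Ql.
have : P (\dim (<[x]> + V)%VS) by apply/asboolP; exists (<[x]> + V)%VS.
move=> /nmax; rewrite -dV leqNgt => /negP; apply.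
rewrite (ltn_leqif (dimv_leqif_sup (addvSr <[x]> V))) subv_add subvv andbT.
by rewrite -memvE.
Qed.

Section semigroup.
Context (R : realType) (k : nat).
Local Notation C := R[i].
Local Notation M := 'M[C]_k.

Lemma closed_zero (f : M -> M) :
  (forall A, f x @[x --> A] --> f A) -> closed [set A | f A = 0].
Proof.
move=> cf A clA /=; apply/matrixP => i j; rewrite [RHS]mxE; apply/eqP.
(* The radius is the modulus of a nonzero entry of f A: a zero of f close enough to A would put that
   entry at distance less than its own modulus from 0. *)
apply: contrapT => /negP; rewrite -normr_gt0 => /complex_gt0_Re[e0 e].
have /cvg_mxP/(_ i j)/cvg_complexP/(_ _ e0) h := cf A.
have [B [/= fB hB]] := clA _ h.
by move: hB; rewrite /= fB mxE subr0 -e ltxx.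
Qed.

Definition gram_propto (p : M) : set M :=
  [set W | mx_propto (p *m W^t* *m W *m p) p].

(** Taking traces forces the scalar, since tr p = |p|^2 is nonzero. Proportionality becomes an
    equation between continuous functions of W, hence a closed condition. *)
Lemma gram_proptoP (p : M) : p != 0 -> ortho_projector p -> forall W,
  gram_propto p W <->
  \tr p *: (p *m W^t* *m W *m p) - \tr (p *m W^t* *m W *m p) *: p = 0.
Proof.
move=> p0 [pp ph] W.
have trp : \tr p != 0.
  have <- : \tr (p^t* *m p) = \tr p by rewrite ph pp.
  by rewrite -sqfrobE -[0]/((0 : R)%:C%C) (inj_eq (@complexI R)) sqfrob_eq0.
rewrite /gram_propto /=; move: (p *m W^t* *m W *m p) => X; split=> [[l ->]|].
  by rewrite mxtraceZ scalerA mulrC subrr.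
move/subr0_eq => h; exists (\tr X / \tr p).
by rewrite mulrC -scalerA -h scalerA mulVf // scale1r.
Qed.

Lemma gram_propto_closed (p : M) : p != 0 -> ortho_projector p -> closed (gram_propto p).
Proof.
move=> p0 hp.
have -> : gram_propto p = [set W | \tr p *: (p *m W^t* *m W *m p) -
    \tr (p *m W^t* *m W *m p) *: p = 0].
  by apply/seteqP; split => W /(gram_proptoP p0 hp).
apply: closed_zero => A.
have FA := nbhs_filter A.
have h := @cvg_id_mx R k k A.
have cp (B : M) := @cvg_cst _ B _ (nbhs A) FA.
have ct (c : C) := @cvg_cst _ c _ (nbhs A) FA.
have hX := cvg_mulmx (FF := FA) (cvg_mulmx (FF := FA)
   (cvg_mulmx (FF := FA) (cp p) (cvg_adjmx (FF := FA) h)) h) (cp p).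
have h1 := cvg_scalemx (FF := FA) (ct (\tr p)) hX.
have h2 := cvg_scalemx (FF := FA) (cvg_mxtrace (FF := FA) hX) (cp p).
exact (@cvgB C M M (nbhs A) FA _ _ _ _ h1 h2).
Qed.

Lemma gram_proptoZ (p W : M) (c : C) : gram_propto p W -> gram_propto p (c *: W).
Proof.
move=> [l hl]; exists (c * Num.conj c * l).
by rewrite adjmxZ -!scalemxAr -!scalemxAl hl !scalerA.
Qed.

Variable mu : {measure set (borel_mx R k) -> \bar R}.

(** The empty word is excluded, in accordance with n >= 1 in (Pur). *)
Definition supp_words : set M :=
  [set W | exists s : seq M, [/\ s != [::], forall v, v \in s -> supp mu v & W = word_prod s]].

Lemma supp_wordsM a b : supp_words a -> supp_words b -> supp_words (a *m b).
Proof.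
move=> [s [s0 ss ->]] [t [t0 ts ->]]; exists (t ++ s).
split; [by case: t t0 {ts} | | by rewrite word_prod_cat].
by move=> v; rewrite mem_cat => /orP[/ts|/ss].
Qed.

Lemma supp_wordsP (p : M) : p != 0 -> ortho_projector p ->
  (forall n, (0 < n)%N -> {ae mpower mu n, forall t,
      mx_propto (p *m adj_prod t *m rev_prod t *m p) p}) <->
  supp_words `<=` gram_propto p.
Proof.
move=> p0 hp; split=> [h W [s [s0 ss ->]]|h n n0].
  apply: contrapT => nW.
  have sn : (0 < size s)%N by case: s s0 {ss nW}.
  have [N [mN N0 hN]] := h (size s) sn.
  (* The failure of proportionality is open, so one bad word of support letters yields a set of
     words of positive mass inside the null set N. *)
  have oC : open (~` gram_propto p) by rewrite openC; exact: gram_propto_closed.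
  have st i : supp mu (tnth (in_tuple s) i) by apply: ss; exact: mem_tnth.
  have [r r0 hr] := mpower_supp_open (t := in_tuple s) st oC nW.
  have := hr N; rewrite N0 lee_fin leNgt r0 => hr'.
  suff : false by [].
  apply: hr' => t /= ht; apply: hN => /= ht'; apply: ht.
  by move: ht'; rewrite /adj_prod adj_word_prod.
(* Conversely, the exceptional null set consists of the words having a letter outside the
   support. *)
exists [set t : n.-tuple (borel_mx R k) | exists i, (~` supp mu) (tnth t i)]; split.
- exact: measurable_exists_tnth (suppC_measurable mu).
- exact: mpower_null (suppC_measurable mu) (measure_suppC mu).
move=> t /=; apply: contra_notP => /forallNP ht.
have := h (word_prod t); rewrite /gram_propto /= -adj_word_prod; apply.
exists t; split => //; first by rewrite -size_eq0 size_tuple -lt0n.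
by move=> v /tnthP[i ->]; apply: contrapT; exact: ht.
Qed.

Lemma supp_sub_Tsemigroup : supp mu `<=` Tsemigroup mu.
Proof. by move=> v sv S [_]; apply. Qed.

Lemma TsemigroupM a b : Tsemigroup mu a -> Tsemigroup mu b -> Tsemigroup mu (a *m b).
Proof.
move=> ha hb S hS; have [[_ SM _] _] := hS.
by apply: SM; [exact: ha|exact: hb].
Qed.

Hypothesis supp_GL : supp mu `<=` @GL R k.

(** By minimality of [Tsemigroup]: the right-hand side is itself a closed subsemigroup containing
    the support. Products of limits are handled one factor at a time. *)
Lemma Tsemigroup_sub : Tsemigroup mu `<=` closure supp_words `&` @GL R k.
Proof.
apply: smallest_sub; last first.
  move=> v sv; split; last exact: supp_GL.
  apply: subset_closure; exists [:: v]; split => //; last by rewrite word_prod_seq1.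
  by move=> w; rewrite inE => /eqP ->.
split; first by move=> v [].
  move=> a b [ca ua] [cb ub]; split; last by rewrite /GL /= unitmx_mul; apply/andP.
  have hr (c : M) : forall A : M, x *m c @[x --> A] --> A *m c.
    move=> A; exact (cvg_mulmx (FF := nbhs_filter A) (@cvg_id_mx R k k A)
      (@cvg_cst _ c _ (nbhs A) (nbhs_filter A))).
  have hl (c : M) : forall A : M, c *m x @[x --> A] --> c *m A.
    move=> A; exact (cvg_mulmx (FF := nbhs_filter A)
      (@cvg_cst _ c _ (nbhs A) (nbhs_filter A)) (@cvg_id_mx R k k A)).
  apply: (closure_preimage (hr b) _ ca) => x wx.
  apply: (closure_preimage (hl x) _ cb) => y wy.
  by apply: subset_closure; exact: supp_wordsM.
by exists (closure supp_words) => //; exact: closed_closure.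
Qed.

Lemma Tsemigroup_GL : Tsemigroup mu `<=` @GL R k.
Proof. by move=> a /Tsemigroup_sub[]. Qed.

Lemma contracting_Pur : strongly_irreducible (Tsemigroup mu) ->
  contracting (Tsemigroup mu) -> Pur mu.
Proof.
move=> irr [a aT [P aP rP]] p p0 hp /(supp_wordsP p0 hp) wp.
have clp := gram_propto_closed p0 hp.
have Tp b : Tsemigroup mu b -> gram_propto p b.
  move=> /Tsemigroup_sub[cb _]; apply: clp.
  by apply: (closureS wp).
(* P b is the limit of the rescaled a_n b, which lie in the closed cone [gram_propto p]. *)
have Pbp b : Tsemigroup mu b -> gram_propto p (P *m b).
  move=> Tb; apply: clp.
  apply: (@cvg_closure _ _ _ _ _
    (fun n => (((op_norm (a n))^-1)%:C%C *: a n) *m b)) => [n|].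
    by rewrite -scalemxAl; apply: gram_proptoZ; apply: Tp; exact: TsemigroupM.
  exact (cvg_mulmx aP (@cvg_cst _ b _ \oo _)).
apply/eqP; rewrite eqn_leq lt0n mxrank_eq0 p0 andbT.
apply: contrapT => rp; apply: irr.
(* With X = P b: if l = 0 then |X p|^2 = 0; if not, p = l^-1 p X^* X p factors through X, so its
   rank is at most 1, against the assumption. *)
have PbpE b : Tsemigroup mu b -> P *m b *m p = 0.
  move=> /Pbp; rewrite /gram_propto /=; move: (P *m b) (mxrankM_maxl P b) => X rX [l hl].
  have [l0|l0] := eqVneq l 0.
    apply/eqP; rewrite -sqfrob_eq0 /sqfrob adjmxM (proj2 hp) !mulmxA.
    by rewrite hl l0 scale0r mxtrace0.
  case: rp; rewrite -rP.
  have -> : p = l^-1 *: (p *m X^t*) *m (X *m p).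
    by rewrite -scalemxAl !mulmxA hl scalerA mulVf // scale1r.
  apply: leq_trans (mxrankM_maxr _ _) _; apply: leq_trans rX; exact: mxrankM_maxl.
(* V is the common kernel of the P b, b in T. It is proper because a_0 is invertible and P is
   nonzero, and it contains the columns of p. *)
have [||V VP] := @vspace_of_linear_closed C 'cV[C]_k
  (fun x => forall b, Tsemigroup mu b -> P *m b *m x = 0).
- by move=> b _; rewrite mulmx0.
- by move=> c x y hx hy b Tb; rewrite mulmxDr -scalemxAr hx // hy // scaler0 addr0.
exists [:: V]; split.
- move=> W; rewrite inE => /eqP ->; apply/eqP => Vfull.
  have P0 : P = 0; last by move: rP; rewrite P0 mxrank0.
  have ua : a 0 \in unitmx by apply: Tsemigroup_GL; exact: aT.
  rewrite -[P](mulmxK ua); apply/matrixP => i j.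
  have -> : P *m a 0 = 0; last by rewrite mul0mx.
  apply/matrixP => i' j'; have /VP/(_ _ (aT 0)) : delta_mx j' 0 \in V.
    by rewrite Vfull memvf.
  by rewrite -colE => /matrixP/(_ i' 0); rewrite !mxE.
- have /existsP[j pj] : [exists j, col j p != 0].
    apply: contraNT p0; rewrite negb_exists => /forallP pj.
    apply/eqP/matrixP => i j; have /negbNE/eqP/matrixP/(_ i 0) := pj j.
    by rewrite !mxE.
  exists (col j p) => //; exists V; first by rewrite inE.
  by apply/VP => b Tb; rewrite colE mulmxA PbpE // mul0mx.
- move=> b x Tb [W]; rewrite inE => /eqP -> /VP xV; exists V; first by rewrite inE.
  by apply/VP => c Tc; rewrite mulmxA -(mulmxA P) xV //; exact: TsemigroupM.
Qed.

End semigroup.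

(** * (Pur) implies contracting *)

Section extremal_limits.
Context (R : realType) (k : nat).
Local Notation C := R[i].
Local Notation M := 'M[C]_k.
Variable mu : {measure set (borel_mx R k) -> \bar R}.

Definition pos_cone (T : set M) : set M :=
  [set B | exists r : R, exists a, [/\ 0 < r, T a & B = r%:C%C *: a]].

Definition unit_limits (T : set M) : set M :=
  [set B | closure (pos_cone T) B /\ sqfrob B = 1].

Lemma gramZ (r : R) (A : M) :
  (r%:C%C *: A)^t* *m (r%:C%C *: A) = (r ^+ 2)%:C%C *: (A^t* *m A).
Proof. by rewrite adjmxZ conj_real -scalemxAl -scalemxAr scalerA expr2 -rmorphM. Qed.

Lemma invr_sqrtr_sqr (x : R) : 0 < x -> (Num.sqrt x)^-1 ^+ 2 = x^-1.
Proof. by move=> x0; rewrite exprVn sqr_sqrtr // ltW. Qed.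

Lemma closure_pos_coneZ (T : set M) (r : R) B : 0 < r ->
  closure (pos_cone T) B -> closure (pos_cone T) (r%:C%C *: B).
Proof.
move=> r0; apply: (closure_preimage (f := fun B => r%:C%C *: B)) => [A|_ [q [a [q0 Ta ->]]]].
  exact (cvg_scalemx (FF := nbhs_filter A)
    (@cvg_cst _ (r%:C%C : C) _ (nbhs A) (nbhs_filter A)) (@cvg_id_mx R k k A)).
apply: subset_closure; exists (r * q), a.
by split; [rewrite mulr_gt0| |rewrite scalerA rmorphM].
Qed.

Lemma closure_pos_coneM (T : set M) v B : (forall a, T a -> T (v *m a)) ->
  closure (pos_cone T) B -> closure (pos_cone T) (v *m B).
Proof.
move=> vT; apply: (closure_preimage (f := fun B => v *m B)) => [A|_ [q [a [q0 Ta ->]]]].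
  exact (cvg_mulmx (FF := nbhs_filter A)
    (@cvg_cst _ v _ (nbhs A) (nbhs_filter A)) (@cvg_id_mx R k k A)).
by apply: subset_closure; exists q, (v *m a); split; [| exact: vT | rewrite scalemxAr].
Qed.

Lemma unit_limits_normalize (T : set M) B : closure (pos_cone T) B -> B != 0 ->
  unit_limits T ((Num.sqrt (sqfrob B))^-1%:C%C *: B).
Proof.
move=> cB /sqfrob_gt0 B0; split.
  by apply: closure_pos_coneZ; rewrite // invr_gt0 sqrtr_gt0.
by rewrite sqfrobZ invr_sqrtr_sqr // mulVf // gt_eqF.
Qed.

(** A closed condition, and Frobenius norm 1 bounds every entry by 1. *)
Lemma unit_limits_compact (T : set M) : compact (unit_limits T).
Proof.
have [K cK Kb] := @bounded_mx_subcompact R k.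
apply: (subclosed_compact _ cK).
  have -> : unit_limits T = closure (pos_cone T) `&` ~` (@sqfrob R k k @^-1` [set x | x != 1]).
    apply/seteqP; split => B /= [cB]; first by move=> ->; split=> //; rewrite eqxx.
    by move=> /negP; rewrite negbK => /eqP.
  apply: closedI; first exact: closed_closure.
  apply: open_closedC; apply: open_preimage_mx; last exact: open_neq.
  by move=> A; exact (cvg_sqfrob (nbhs_filter A) (@cvg_id_mx R k k A)).
move=> B [_ B1]; apply: Kb => i j.
rewrite -(@expr_le1 _ 2) //; apply: (le_trans (sqfrob_entry B i j)).
by rewrite B1.
Qed.

Lemma unit_limits_max (T : set M) : unit_limits T !=set0 ->
  exists2 A, unit_limits T A &
    forall B, unit_limits T B -> sqfrob (B^t* *m B) <= sqfrob (A^t* *m A).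
Proof.
move=> K0.
have [|A /set_mem AK Amax] := @compact_EVT_max _ R (fun B : M => sqfrob (B^t* *m B)) _ K0
  (@unit_limits_compact T).
  apply: continuous_subspaceT => A.
  have FA := nbhs_filter A.
  exact (cvg_sqfrob FA (cvg_mulmx (FF := FA) (cvg_adjmx (FF := FA) (@cvg_id_mx R k k A))
    (@cvg_id_mx R k k A))).
by exists A => // B KB; apply: Amax; exact: mem_set.
Qed.

(** Write A as the limit of r_n a_n with r_n > 0. Normalization by the operator norm cancels r_n, so
    that a_n / |a_n| tends to A / |A|. *)
Lemma contracting_of_rank1 (T : set M) A : T `<=` @GL R k -> (0 < k)%N ->
  unit_limits T A -> \rank A = 1%N -> contracting T.
Proof.
move=> TGL k0 [/closure_seq[u uT uA] A1] rA.
have A0 : A != 0 by rewrite -sqfrob_eq0 A1 oner_eq0.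
have /choice[ra raP] n : exists ra : R * M, [/\ 0 < ra.1, T ra.2 & u n = ra.1%:C%C *: ra.2].
  by have [r [a [r0 Ta ->]]] := uT n; exists (r, a).
exists (fun n => (ra n).2); first by move=> n; case: (raP n).
exists (((op_norm A)^-1)%:C%C *: A).
  have -> : (fun n => ((op_norm (ra n).2)^-1)%:C%C *: (ra n).2) =
            (fun n => ((op_norm (u n))^-1)%:C%C *: u n).
    apply/funext => n; case: (raP n) => r0 _ ->.
    rewrite op_normZ // scalerA -rmorphM invfM mulrAC mulVf ?mul1r //.
    by rewrite gt_eqF.
  have oA : (fun n => op_norm (u n)) @ \oo --> op_norm A by exact: cvg_op_norm.
  have oA0 : op_norm A != 0 by rewrite gt_eqF // op_norm_gt0.
  have viA : (fun n => (op_norm (u n))^-1) @ \oo --> (op_norm A)^-1.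
    exact (@cvgV R nat \oo _ (fun n => op_norm (u n)) _ oA0 oA).
  exact (cvg_scalemx (cvg_real_complex viA) uA).
rewrite mxrank_scale_nz // -[0]/((0 : R)%:C%C) (inj_eq (@complexI R)) invr_eq0.
by rewrite gt_eqF // op_norm_gt0.
Qed.

Hypothesis mu_fin : (\int[mu]_v ((op_norm v) ^+ 2)%:E < +oo)%E.
Hypothesis mu_id : mx_integral mu (fun v => v^t* *m v) = 1%:M.

(** With empty support mu would vanish, whereas the integral of |v|^2 is |Id|^2, which is nonzero
    for k > 0. *)
Lemma supp_nonempty : (0 < k)%N -> supp mu !=set0.
Proof.
move=> k0; apply/set0P/eqP => s0.
have [_] := has_integral_sqfrob mu_fin mu_id (1%:M : M).
rewrite (integral_null_support (Z := (~` supp mu : set (borel_mx R k)))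
  (suppC_measurable mu) (measure_suppC mu)).
- move=> [] /esym/eqP; rewrite sqfrob_eq0 => /eqP /matrixP/(_ (Ordinal k0) (Ordinal k0)).
  by rewrite !mxE eqxx => /eqP; rewrite oner_eq0.
- by move=> x; rewrite lee_fin sqfrob_ge0.
- by rewrite s0 setC0 => x []; rewrite /=.
Qed.

Variable T : set M.
Hypothesis suppT : forall v a, supp mu v -> T a -> T (v *m a).
Hypothesis supp_unit : forall v, supp mu v -> v \in unitmx.

(** The squared singular values of A sum to 1, and the sum of their squares is maximized: a measure
    of closeness to rank one. *)
Definition gram_maximal (A : M) := unit_limits T A /\
  forall B, unit_limits T B -> sqfrob (B^t* *m B) <= sqfrob (A^t* *m A).

Lemma gram_maximal_supp A v : gram_maximal A -> supp mu v ->
  (v *m A)^t* *m (v *m A) = (sqfrob (v *m A))%:C%C *: (A^t* *m A).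
Proof.
move=> [[cA A1] Amax] sv.
set s := sqfrob (A^t* *m A).
pose g (w : M) := s * sqfrob (w *m A) - sqfrob (w *m (A *m A^t*)).
have AAs : sqfrob (A *m A^t*) = s.
  apply: complexI; rewrite -mxtrace_gramM /s sqfrobE adjmx_self //.
(* The integral is s |A|^2 - |A A^*|^2 = s - s. *)
have ig : has_integral mu g 0.
  have := has_integralB (has_integralZ s (has_integral_sqfrob mu_fin mu_id A))
    (has_integral_sqfrob mu_fin mu_id (A *m A^t*)).
  by rewrite A1 mulr1 AAs subrr.
have cg B : g x @[x --> B] --> g B.
  have FB := nbhs_filter B.
  have h X := cvg_sqfrob FB (cvg_mulmx (FF := FB) (@cvg_id_mx R k k B)
    (@cvg_cst _ (X : M) _ (nbhs B) FB)).
  have hs := @cvgM R _ (nbhs B) FB _ _ _ _ (@cvg_cst _ s _ (nbhs B) FB) (h A).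
  exact (@cvgB R R M (nbhs B) FB _ _ _ _ hs (h (A *m A^t*))).
have A0 : A != 0 by rewrite -sqfrob_eq0 A1 oner_eq0.
have key w : supp mu w -> 0 <= sqfrob ((w *m A)^t* *m (w *m A) -
    (sqfrob (w *m A))%:C%C *: (A^t* *m A)) <= 2 * sqfrob (w *m A) * g w /\
    0 < sqfrob (w *m A).
  move=> sw.
  have wA0 : w *m A != 0.
    by apply: contraNneq A0 => wA; rewrite -(mulKmx (supp_unit sw) A) wA mulmx0.
  have q0 := sqfrob_gt0 wA0; split => //.
  rewrite sqfrob_ge0 /= sqfrob_gram_sub -/s /g.
  (* Maximality against the normalized w A bounds |A^* w^* w A|^2 by s |w A|^4; inserted into the
     expansion, this gives the upper bound. *)
  have := Amax _ (unit_limits_normalize (closure_pos_coneM (fun a => @suppT w a sw) cA) wA0).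
  rewrite gramZ sqfrobZ invr_sqrtr_sqr // exprVn -/s ler_pdivrMl ?exprn_gt0 //.
  move: (sqfrob (w *m A)) (sqfrob (w *m (A *m A^t*))) (sqfrob ((w *m A)^t* *m (w *m A))).
  move=> a b c h; rewrite -subr_ge0.
  have -> : 2 * a * (s * a - b) - (c - 2 * a * b + a ^+ 2 * s) = a ^+ 2 * s - c by ring.
  by rewrite subr_ge0.
have gv : g v = 0.
  apply: (continuous_integral0_supp cg ig _ sv) => w /key[/andP[h1 h2] h3].
  by have := le_trans h1 h2; rewrite pmulr_rge0 // mulr_gt0.
have [+ _] := key v sv; rewrite gv mulr0 => /le_anti h.
by apply/eqP; rewrite -subr_eq0 -sqfrob_eq0 -h.
Qed.

(** The rescaled v A has the same Gram matrix as A, hence is again maximal; this drives the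
    induction on words. *)
Lemma gram_maximal_normalize A v : gram_maximal A -> supp mu v ->
  exists c : R, [/\ 0 < c, gram_maximal (c%:C%C *: (v *m A)) &
    (c%:C%C *: (v *m A))^t* *m (c%:C%C *: (v *m A)) = A^t* *m A].
Proof.
move=> mA sv; have h := gram_maximal_supp mA sv.
have [[cA A1] Amax] := mA.
have A0 : A != 0 by rewrite -sqfrob_eq0 A1 oner_eq0.
have vA0 : v *m A != 0.
  by apply: contraNneq A0 => vA; rewrite -(mulKmx (supp_unit sv) A) vA mulmx0.
have q0 := sqfrob_gt0 vA0.
have gE : ((Num.sqrt (sqfrob (v *m A)))^-1%:C%C *: (v *m A))^t* *m
  ((Num.sqrt (sqfrob (v *m A)))^-1%:C%C *: (v *m A)) = A^t* *m A.
  by rewrite gramZ invr_sqrtr_sqr // h scalerA -rmorphM mulVf ?gt_eqF // scale1r.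
exists (Num.sqrt (sqfrob (v *m A)))^-1; split; [by rewrite invr_gt0 sqrtr_gt0| |exact gE].
split; last by move=> B KB; rewrite gE; exact: Amax.
exact (unit_limits_normalize (closure_pos_coneM (fun a => @suppT v a sv) cA) vA0).
Qed.

(** Induction on the word with A varying: the first letter is absorbed into A, and the factor c^2 of
    the rescaling is divided out. *)
Lemma gram_maximal_words s A : gram_maximal A -> (forall v, v \in s -> supp mu v) ->
  exists l : C, (word_prod s *m A)^t* *m (word_prod s *m A) = l *: (A^t* *m A).
Proof.
elim: s A => [|v s ih] A mA ss.
  by exists 1; rewrite word_prod_nil mul1mx scale1r.
have sv : supp mu v by apply: ss; rewrite mem_head.
have ss' w : w \in s -> supp mu w by move=> ws; apply: ss; rewrite inE ws orbT.
have [c [c0 mB gB]] := gram_maximal_normalize mA sv.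
have [l] := ih _ mB ss'.
have -> : word_prod s *m (c%:C%C *: (v *m A)) = c%:C%C *: (word_prod (v :: s) *m A).
  by rewrite -scalemxAr word_prod_cons mulmxA.
rewrite gB gramZ.
have c0' : (c ^+ 2)%:C%C != 0 :> C.
  by rewrite -[0]/((0 : R)%:C%C) (inj_eq (@complexI R)) gt_eqF // exprn_gt0.
move=> h; exists ((c ^+ 2)%:C%C^-1 * l).
by rewrite -scalerA -h scalerA mulVf // scale1r.
Qed.

Lemma gram_maximal_projector A : gram_maximal A -> exists p : M,
  [/\ p != 0, ortho_projector p, \rank A = \rank p & supp_words mu `<=` gram_propto p].
Proof.
move=> mA; have [p [pp pA [Z pAZ]]] := ortho_projectorP A.
have A0 : A != 0 by have [[_ A1] _] := mA; rewrite -sqfrob_eq0 A1 oner_eq0.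
exists p; split => //.
- by apply: contraNneq A0 => p0; rewrite -pA p0 mul0mx.
- apply/eqP; rewrite eqn_leq -{1}pA mxrankM_maxl /=.
  by rewrite pAZ mxrankM_maxl.
move=> _ [s [_ ss ->]]; have [l hl] := gram_maximal_words mA ss; exists l.
have [p2 ph] := pp.
(* Transfers the relation from A to p = A Z; the case W = 1 identifies Z^* A^* A Z with p. *)
have e (W : M) : p *m W^t* *m W *m p = Z^t* *m ((W *m A)^t* *m (W *m A)) *m Z.
  by rewrite -{1}ph pAZ !adjmxM !mulmxA.
rewrite e hl -scalemxAr -scalemxAl; congr (_ *: _).
have := e 1%:M; rewrite trmx1 map_mx1 !mulmx1 mul1mx p2 => <-.
by [].
Qed.

End extremal_limits.

Theorem propositionA1 (R : realType) (k : nat) (k_gt0 : (0 < k)%N)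
    (mu : {sigma_finite_measure set (borel_mx R k) -> \bar R})
    (mu_fin : (\int[mu]_v ((op_norm v) ^+ 2)%:E < +oo)%E)
    (mu_id : mx_integral mu (fun v => v^t* *m v) = 1%:M)
    (supp_GL : supp mu `<=` @GL R k)
    (irr : strongly_irreducible (Tsemigroup mu)) :
  Pur mu <-> contracting (Tsemigroup mu).
Proof.
split; last exact: contracting_Pur.
move=> pur.
have TGL := Tsemigroup_GL supp_GL.
have suppT v a : supp mu v -> Tsemigroup mu a -> Tsemigroup mu (v *m a).
  by move=> sv; apply: TsemigroupM; exact: supp_sub_Tsemigroup.
have [v0 sv0] := supp_nonempty mu_fin mu_id k_gt0.
have v0n : v0 != 0.
  apply/eqP => v00; have := mxrank_unit (supp_GL _ sv0).
  by rewrite v00 mxrank0 => k0; move: k_gt0; rewrite -k0.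
have K0 : unit_limits (Tsemigroup mu) !=set0.
  eexists; apply: unit_limits_normalize v0n; apply: subset_closure.
  by exists 1, v0; split => //; [exact: supp_sub_Tsemigroup|rewrite scale1r].
have [A KA Amax] := unit_limits_max K0.
have [p [p0 pp rp /(supp_wordsP _ p0 pp) ph]] :=
  gram_maximal_projector mu_fin mu_id suppT supp_GL (conj KA Amax).
apply: (contracting_of_rank1 TGL k_gt0 KA); rewrite rp.
exact: pur.
Qed.
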